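(* Let $G$ be a locally finite connected graph (which may be directed or undirected) with countably infinite vertex set $V$, and let $\mathbb{K}\in\{\mathbb{R},\mathbb{C}\}$. Every linear operator $A:\mathbb{K}^V\rightarrow\mathbb{K}^V$ which has finite hopping range and satisfies the pointwise maximum principle is surjective.
   Context: $\mathbb{N}=\{1,2,3,\ldots\}$. $\mathbb{K}^V$ is the $\mathbb{K}$-vector space of all functions $f:V\to\mathbb{K}$. Graphs: a graph $G$ with vertex set $V$ is given by a set of edges, which are ordered pairs $(v,w)\in V\times V$. It is undirected if $(w,v)$ is an edge whenever $(v,w)$ is an edge; in general it may be directed. $G$ is locally finite if every vertex $v$ has only finitely many adjacent vertices, i.e. there are only finitely many $w\in V$ such that $(v,w)$ or $(w,v)$ is an edge. $G$ is connected if for any two different vertices $v,w$ there is a finite path of edges $(v_0,v_1),(v_1,v_2),\ldots,(v_{n-1},v_n)$ of $G$ with $v\in\{v_0,v_n\}$ and $w\in\{v_0,v_n\}$ (so the path leads from $v$ to $w$ or from $w$ to $v$). Such a path starts in $v_0$, ends in $v_n$, and has length $n$. For $v\in V$ and $n\in\mathbb{N}$, $U_n(v)$ denotes the union of $\{v\}$ with the set of all endpoints of paths in $G$ starting in $v$ of length not exceeding $n$ and the set of all starting points of paths in $G$ ending in $v$ of length not exceeding $n$. Finite hopping range: a linear map $A:\mathbb{K}^V\to\mathbb{K}^V$ has finite hopping range if for every $v\in V$ there is $n\in\mathbb{N}$ such that for all $f,g\in\mathbb{K}^V$, $f_{|U_n(v)}=g_{|U_n(v)}$ implies $A(f)(v)=A(g)(v)$.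 Pointwise maximum principle: a linear map $A:\mathbb{K}^V\to\mathbb{K}^V$ satisfies the pointwise maximum principle if for every $v\in V$ there is $n\in\mathbb{N}$ such that for each $f\in\mathbb{K}^V$ with $A(f)(v)=0$ the following implication holds: if $|f(v)|=\max_{w\in U_n(v)}|f(w)|$, then $|f(w)|=|f(v)|$ for all $w\in U_n(v)$. *)

(* Defs.v *)
From HB Require Import structures.
From mathcomp Require Import all_boot all_order all_algebra.
From mathcomp Require Import all_classical all_reals.
From mathcomp Require Import complex.

Set Implicit Arguments.
Unset Strict Implicit.
Unset Printing Implicit Defensive.

Import Order.TTheory GRing.Theory Num.Theory.

Local Open Scope classical_set_scope.
Local Open Scope ring_scope.

(* A graph on V is its edge relation E : rel V, not assumed symmetric:      *)
(* E v w means that the ordered pair (v, w) is an edge.                     *)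

Definition locally_finite (V : Type) (E : rel V) : Prop :=
  forall v, finite_set [set w | E v w || E w v].

Definition path_of_length (V : Type) (E : rel V) (n : nat) (v w : V) : Prop :=
  exists p : seq V, [/\ path E v p, last v p = w & size p = n].

(* Weaker than strong connectedness: for each pair of vertices a path in    *)
(* one of the two directions is enough.                                     *)
Definition connected_graph (V : Type) (E : rel V) : Prop :=
  forall v w, v <> w ->
    exists n, path_of_length E n v w \/ path_of_length E n w v.

Definition graph_nbhd (V : Type) (E : rel V) (n : nat) (v : V) : set V :=
  [set v]
  `|` [set w | exists2 m, (m <= n)%N & path_of_length E m v w]
  `|` [set w | exists2 m, (m <= n)%N & path_of_length E m w v].

Definition is_maximum (K : numFieldType) (S : set K) (x : K) : Prop :=
  S x /\ ubound S x.

Definition finite_hopping_range (K : numFieldType) (V : Type) (E : rel V)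
    (A : (V -> K) -> (V -> K)) : Prop :=
  forall v, exists2 n, (0 < n)%N &
    forall f g : V -> K,
      (forall w, graph_nbhd E n v w -> f w = g w) -> A f v = A g v.

Definition pointwise_maximum_principle (K : numFieldType) (V : Type)
    (E : rel V) (A : (V -> K) -> (V -> K)) : Prop :=
  forall v, exists2 n, (0 < n)%N &
    forall f : V -> K, A f v = 0 ->
      is_maximum [set `|f w| | w in graph_nbhd E n v] `|f v| ->
      forall w, graph_nbhd E n v w -> `|f w| = `|f v|.

(* Main.v *)
Require Import Defs.
From HB Require Import structures.
From mathcomp Require Import all_boot all_order all_algebra.
From mathcomp Require Import all_classical all_reals.
From mathcomp Require Import complex.

Set Implicit Arguments.
Unset Strict Implicit.
Unset Printing Implicit Defensive.

Import Order.TTheory GRing.Theory Num.Theory.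

Local Open Scope classical_set_scope.
Local Open Scope ring_scope.

(** Call a linear system row-finite if each of its equations involves finitely
    many unknowns.  Over any field, such a system is solvable as soon as all
    its finite subsystems are.  Local finiteness of the graph and the finite
    hopping range make [A f = g] row-finite, so it remains to solve [A f = g]
    on an arbitrary finite set [F] of vertices.

    This can be done with [f] supported in [F].  The restriction of [A] to such
    functions, read off on [F], is a square system, hence solvable once it is
    injective ([solve_finitely_many]).  Suppose that [f] is supported in [F],
    that [A f] vanishes on [F] and that [f] is not zero.  Then [|f|] attains a
    positive maximum, and every vertex where it is attained lies in [F].  At
    such a vertex the maximum principle applies and spreads the maximum to all
    adjacent vertices.  By connectedness [|f|] is a nonzero constant, which
    contradicts the finiteness of [F] ([maximum_principle_eq0]).

    For the passage from finite subsystems to the whole system ([solve_all]),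
    the values of a solution are fixed one unknown at a time, keeping the
    finite subsystems solvable with the values already fixed
    ([extendable_step]).  In the limit each equation holds, since its finitely
    many unknowns have their final values after finitely many steps.  Vertices
    are enumerated by a bijection [e : nat -> V] with inverse [idx], and the
    finite subsystems are taken along initial segments of the enumeration. *)

(** * Neighbourhoods in locally finite graphs *)

(** Walks in this symmetrized relation may change direction at each edge, so
    they include the directed paths into and out of a vertex. *)
Definition adjacent (V : Type) (E : rel V) : rel V :=
  fun v w => E v w || E w v.

Lemma path_of_length_adjacent (V : Type) (E : rel V) (n : nat) (v w : V) :
  path_of_length E n v w \/ path_of_length E n w v ->
  path_of_length (adjacent E) n v w.
Proof.
case=> -[p [Ep <- <-]].
  exists p; split => //.
  by apply: sub_path Ep => x y Exy; rewrite /adjacent Exy.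
exists (rev (belast w p)); split.
- rewrite rev_path.
  by apply: sub_path Ep => x y Exy; rewrite /adjacent Exy orbT.
- by case: p {Ep} => //= x p; rewrite rev_cons last_rcons.
- by rewrite size_rev size_belast.
Qed.

Lemma finite_sphere (V : Type) (E : rel V) (n : nat) (v : V) :
  locally_finite E -> finite_set [set w | path_of_length (adjacent E) n v w].
Proof.
move=> hlf; elim: n v => [|n IHn] v.
  apply: (@sub_finite_set _ _ [set v]) => [w [p [_ <-]]|]; last exact: finite_set1.
  by move/size0nil->.
apply: (@sub_finite_set _ _ (\bigcup_(u in [set u | E v u || E u v])
    [set w | path_of_length (adjacent E) n u w])).
  move=> w [[|u p] [//= /andP[Evu Ep] pw [sp]]].
  by exists u => //; exists p.
by apply: bigcup_finite => [|u _]; [exact: hlf | exact: IHn].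
Qed.

Lemma finite_graph_nbhd (V : Type) (E : rel V) (n : nat) (v : V) :
  locally_finite E -> finite_set (graph_nbhd E n v).
Proof.
move=> hlf.
apply: (@sub_finite_set _ _ (\bigcup_(m in `I_n.+1)
    [set w | path_of_length (adjacent E) m v w])).
  move=> w [[->|[m mn vw]]|[m mn wv]].
  - by exists 0%N => //; exists [::].
  - by exists m => //; apply: path_of_length_adjacent; left.
  - by exists m => //; apply: path_of_length_adjacent; right.
by apply: bigcup_finite => // m _; exact: finite_sphere.
Qed.

Lemma graph_nbhd_adjacent (V : Type) (E : rel V) (n : nat) (v w : V) :
  (0 < n)%N -> adjacent E v w -> graph_nbhd E n v w.
Proof.
move=> n0 /orP[vw|wv]; [left; right|right]; exists 1%N => //.
  by exists [:: w]; rewrite /= vw.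
by exists [:: v]; rewrite /= wv.
Qed.

(** A set of vertices closed under adjacency absorbs every path that meets it,
    whichever way the path is directed; this is why a path in only one of the
    two directions is enough for the maximum principle to spread. *)
Lemma connected_graph_closed (V : Type) (E : rel V) (S : set V) :
  connected_graph E -> (forall v w, S v -> adjacent E v w -> S w) ->
  forall v w, S v -> S w.
Proof.
move=> hconn Sadj v w Sv; have [<-//|/hconn[n vw]] := pselect (v = w).
have {vw}[p [vp <- _]] := path_of_length_adjacent vw.
elim: p v Sv vp => //= u p IHp v Sv /andP[vu up].
exact: IHp (Sadj _ _ Sv vu) up.
Qed.

(** * The maximum principle on finitely supported functions *)

(** Where [|f|] is maximal and nonzero, [A f] vanishes, so the maximum principle
    moves the maximum to the adjacent vertices and in the end to the vertex
    [e n], where [f] is zero. *)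
Lemma maximum_principle_eq0 (K : numFieldType) (V : Type) (E : rel V)
    (A : (V -> K) -> (V -> K)) (e : nat -> V) (idx : V -> nat)
    (idxK : cancel idx e) (eK : cancel e idx) (n : nat) (f : V -> K) :
  connected_graph E -> pointwise_maximum_principle E A ->
  (forall v, (n <= idx v)%N -> f v = 0) ->
  (forall v, (idx v < n)%N -> A f v = 0) ->
  forall v, f v = 0.
Proof.
move=> hconn hmax f0 Af0 v; apply: contrapT => /eqP fv.
have lt_idx u : f u != 0 -> (idx u < n)%N.
  by move=> fu; rewrite ltnNge; apply: contraNN fu => /f0 ->.
pose F (i : 'I_n) := `|f (e i)|.
have [i _ maxF] := @real_arg_maxP K 'I_n (Ordinal (lt_idx v fv)) xpredT F isT
  (fun i _ => normr_real _).
have le_max u : `|f u| <= F i.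
  have [->|/lt_idx un] := eqVneq (f u) 0; first by rewrite normr0 normr_ge0.
  by have := maxF (Ordinal un) isT; rewrite /F /= idxK.
have max_gt0 : 0 < F i by apply: lt_le_trans (le_max v); rewrite normr_gt0.
(* The set where the maximum is attained is closed under adjacency. *)
have allmax : `|f (e n)| = F i.
  apply: (connected_graph_closed (S := [set u | `|f u| = F i]) hconn _
            (v := e i)) => // u w /= fu uw.
  have [m m0 hm] := hmax u.
  rewrite -fu; apply: hm; last exact: graph_nbhd_adjacent.
    by apply/Af0/lt_idx; rewrite -normr_gt0 fu.
  split; first by exists u => //; left; left.
  by move=> _ [x _ <-]; rewrite fu.
by move: max_gt0; rewrite -allmax f0 ?eK// normr0 ltxx.
Qed.

(** * Solving finitely many equations, then all of them *)

(** On functions supported on the first [n] vertices, the first [n] equations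
    form a square system, for which uniqueness gives existence. *)
Lemma solve_finitely_many (K : fieldType) (V : Type)
    (A : {linear (V -> K^o) -> (V -> K^o)}) (e : nat -> V) (idx : V -> nat)
    (idxK : cancel idx e) (eK : cancel e idx) (n : nat)
    (Ainj : forall f : V -> K^o, (forall v, (n <= idx v)%N -> f v = 0) ->
       (forall v, (idx v < n)%N -> A f v = 0) -> forall v, f v = 0)
    (g : V -> K) :
  exists f : V -> K^o, forall i, (i < n)%N -> A f (e i) = g (e i).
Proof.
pose delta (j : 'I_n) : V -> K^o := fun v => (idx v == j)%:R.
pose fun_of (x : 'rV[K]_n) : V -> K^o := \sum_j x 0 j *: delta j.
pose M : 'M[K]_n := \matrix_(j, i) A (delta j) (e i).
have fun_ofE x v : fun_of x v = \sum_j x 0 j * (idx v == j)%:R.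
  by rewrite /fun_of fct_sumE; apply: eq_bigr => j _; rewrite scalrfctE.
have AE x (i : 'I_n) : A (fun_of x) (e i) = (x *m M) 0 i.
  rewrite /fun_of linear_sum fct_sumE mxE; apply: eq_bigr => j _.
  by rewrite linearZ /= scalrfctE mxE.
have Munit : M \in unitmx.
  rewrite -row_free_unit; apply: inj_row_free => x xM0; apply/rowP => j.
  have : fun_of x (e j) = 0.
    apply: Ainj => v vn.
      rewrite fun_ofE big1// => k _; case: eqP vn => [->|_ _]; last exact: mulr0.
      by rewrite leqNgt ltn_ord.
    by rewrite -(idxK v) (AE x (Ordinal vn)) xM0 mxE.
  rewrite fun_ofE (bigD1 j)//= eK eqxx mulr1 big1 ?addr0 ?mxE// => k kj.
  by rewrite eq_sym (negbTE (kj : (k : nat) != j)) mulr0.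
exists (fun_of ((\row_i g (e i)) *m invmx M)) => i lt_in.
by rewrite (AE _ (Ordinal lt_in)) mulmxKV// mxE.
Qed.

(** The values of [p] at the first [k] vertices are the part of the solution
    fixed so far.  A solution of each finite subsystem may continue them in its
    own way; no single continuation is claimed to solve all equations. *)
Definition extendable (K : fieldType) (V : Type) (A : (V -> K) -> (V -> K))
    (g : V -> K) (e : nat -> V) (k : nat) (p : V -> K) : Prop :=
  forall n, exists f : V -> K, (forall i, (i < n)%N -> A f (e i) = g (e i)) /\
    (forall i, (i < k)%N -> f (e i) = p (e i)).

(** The values that solutions of the first [n] equations, with the first [k]
    values fixed, take at [e k] form a nonempty affine subspace of [K], so
    either a point or all of [K].  If it is a point for some [N], that point is
    the value to choose: larger subsystems are still solvable, and can only take
    this value.  Otherwise any value works. *)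
Lemma extendable_step (K : fieldType) (V : Type)
    (A : {linear (V -> K^o) -> (V -> K^o)}) (g : V -> K) (e : nat -> V)
    (k : nat) (p : V -> K) :
  extendable A g e k p ->
  exists q : V -> K, extendable A g e k.+1 q /\
    (forall i, (i < k)%N -> q (e i) = p (e i)).
Proof.
move=> pext.
pose sol n (f : V -> K) := (forall i, (i < n)%N -> A f (e i) = g (e i)) /\
    (forall i, (i < k)%N -> f (e i) = p (e i)).
have [[N forced]|free] := pselect (exists N, forall f f',
    sol N f -> sol N f' -> f (e k) = f' (e k)).
  have [q solq] := pext N; exists q; split=> [n|]; last exact: solq.2.
  have [f [fA fp]] := pext (maxn N n); exists f; split.
    by move=> i lt_in; apply: fA; rewrite leq_max lt_in orbT.
  move=> i; rewrite ltnS leq_eqVlt => /orP[/eqP->|ik].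
    apply: forced => //; split=> // j jN.
    by apply: fA; rewrite leq_max jN.
  by rewrite fp// solq.2.
(* No subsystem determines the value at [e k]: keep that of any solution, and
   reach it for each [n] on the line through two solutions. *)
have [q solq] := pext 0%N; exists q; split=> [n|]; last exact: solq.2.
have [f1 [f2 [[f1A f1p] [f2A f2p] f12]]] :
    exists f1 f2, [/\ sol n f1, sol n f2 & f1 (e k) != f2 (e k)].
  apply: contrapT => no; apply: free; exists n => f f' solf solf'.
  by apply: contrapT => /eqP ff'; apply: no; exists f, f'.
pose t := (q (e k) - f1 (e k)) / (f2 (e k) - f1 (e k)).
pose f : V -> K^o := (f1 : V -> K^o) + t *: ((f2 : V -> K^o) - (f1 : V -> K^o)).
have fE v : f v = f1 v + t * (f2 v - f1 v).
  by rewrite /f addrfctE scalrfctE /= addrfctE opprfctE.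
exists f; split=> i ik.
  rewrite linearD linearZ linearB /= !fctE f1A// f2A//.
  by rewrite subrr scaler0 addr0.
rewrite fE; move: ik; rewrite ltnS leq_eqVlt => /orP[/eqP->|ik].
  have d0 : f2 (e k) - f1 (e k) != 0 by rewrite subr_eq0 eq_sym.
  by rewrite /t divfK// addrC subrK.
by rewrite f1p// f2p// subrr mulr0 addr0 solq.2.
Qed.

(** The functions of [extendable_step] agree on longer and longer initial
    segments; their limit [f] agrees, on the unknowns of the equation at [v],
    with a solution of a finite subsystem containing that equation. *)
Lemma solve_all (K : fieldType) (V : Type)
    (A : {linear (V -> K^o) -> (V -> K^o)}) (e : nat -> V) (idx : V -> nat)
    (idxK : cancel idx e) (g : V -> K)
    (Aloc : forall v, exists k, forall f f' : V -> K,
      (forall i, (i < k)%N -> f (e i) = f' (e i)) -> A f v = A f' v)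
    (Asol : forall n, exists f : V -> K,
      forall i, (i < n)%N -> A f (e i) = g (e i)) :
  exists f : V -> K, A f = g.
Proof.
pose state := {x : nat * (V -> K) | extendable A g e x.1 x.2}.
pose next (x y : state) := (sval y).1 = (sval x).1.+1 /\
  forall i, (i < (sval x).1)%N -> (sval y).2 (e i) = (sval x).2 (e i).
have ext0 : extendable A g e 0 (fun=> 0).
  by move=> n; have [f fA] := Asol n; exists f.
have [|s [s0 sS]] := @dependent_choice state next _ (exist _ (0%N, fun=> 0) ext0).
  move=> [[k p] pext]; apply: cid.
  have [q [qext qp]] := extendable_step pext.
  by exists (exist _ (k.+1, q) qext).
have s1 k : (sval (s k)).1 = k.
  by elim: k => [|k IHk]; rewrite ?s0//; have [-> _] := sS k; rewrite IHk.
pose p k := (sval (s k)).2.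
have pext k : extendable A g e k (p k) by have := svalP (s k); rewrite s1.
have pS k i : (i < k)%N -> p k.+1 (e i) = p k (e i).
  by move=> ik; have [_] := sS k; apply; rewrite s1.
have pD k i d : (i < k)%N -> p (d + k)%N (e i) = p k (e i).
  by move=> ik; elim: d => // d <-; rewrite addSn pS// (leq_trans ik)// leq_addl.
(* The value at [v] no longer changes once the first [idx v + 1] are fixed. *)
pose f v := p (idx v).+1 v.
have fp k i : (i < k)%N -> f (e i) = p k (e i).
  (* Only [idxK] is available, so [idx (e i)] need not be [i]; compare both
     stages with a common later one. *)
  move=> ik; rewrite /f; set j := idx (e i).
  have ej : e i = e j by rewrite /j idxK.
  rewrite {1}ej -(pD j.+1 j k)// addnC -ej.
  by apply: pD.
exists f; apply/funext => v; have [k Ak] := Aloc v.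
have [f' [f'A f'p]] := pext k (idx v).+1.
have := f'A (idx v) (ltnSn _); rewrite idxK => <-.
by apply: Ak => i ik; rewrite (fp k)// f'p.
Qed.

(** * Surjectivity *)

Theorem theorem1 (R : realType) (K : numFieldType)
    (hK : K = R :> numFieldType \/ K = R[i] :> numFieldType)
    (V : Type) (hV : ([set: V] #= [set: nat])%card)
    (E : rel V) (hlf : locally_finite E) (hconn : connected_graph E)
    (A : {linear (V -> K^o) -> (V -> K^o)})
    (hrange : finite_hopping_range E A)
    (hmax : pointwise_maximum_principle E A) :
  set_surj [set: V -> K] [set: V -> K] A.
Proof.
have [idx] := card_set_bijP hV; rewrite setTT_bijective => -[e idxK eK].
move=> g _; suff [f <-] : exists f : V -> K, A f = g by exists f.
apply: (solve_all idxK) => [v|n]; last first.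
  apply: (solve_finitely_many idxK eK) => f.
  exact: (@maximum_principle_eq0 K V E A e idx idxK eK n f hconn hmax).
have [n _ Av] := hrange v.
have [k hk] : exists k, forall w, graph_nbhd E n v w -> (idx w < k)%N.
  have /(finite_image idx) := finite_graph_nbhd n v hlf.
  move=> /finite_seqP[s sE]; exists (\max_(i <- s) i).+1 => w vw.
  have : [set` s] (idx w) by rewrite -sE; exists w.
  by move=> /= ws; rewrite ltnS (@leq_bigmax_seq nat s xpredT id).
exists k => f f' ff'; apply: Av => w /hk wk.
by rewrite -(idxK w); exact: ff'.
Qed.
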